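(* Consider a Cayley-Klein space of dimension $n$ given by $Q_0,A_1,Q_1,\dots,A_r,Q_r,A_{r+1}=\varnothing$ (with $A_0=P^n(\mathbb{R})$) such that $A_1$ is not a hyperplane of $P^n(\mathbb{R})$. Let $X$ be a point of $P^n(\mathbb{R})$ not in $A_1$ and $L$ a line through $X$. Let $X^p$ be the polar of $X$ with respect to $Q_0$. Then: 1. If $X\notin Q_0$, then $L$ is a tangent line (i.e. tangent to the absolute figure) if and only if it passes through a point of $X^p\cap Q_0$. 2. If $X\in Q_0$, then $L$ is a tangent line if and only if $L\subseteq X^p$.
   Context: Conventions. Subspaces are projective subspaces, including $\varnothing$ (of dimension $-1$) and the whole space; $\dim$ is projective dimension; $S+T$ is the smallest subspace containing $S$ and $T$; a point $X$ is identified with $\{X\}$. A hyperplane of a subspace $S$ is a subspace of $S$ of dimension $\dim S-1$. A set of points is independent if representing vectors are linearly independent; a set of hyperplanes is independent if the linear forms defining them are linearly independent. The intersection of the empty family of hyperplanes is the whole space. Quadrics. A quadric $Q$ in a real projective space $P(V)$ is the set $\{[x] : f(x,x)=0\}$ for a symmetric bilinear form $f$ on $V$ that is not identically zero; it is considered together with $f$. Points $[x],[y]$ are conjugate with respect to $Q$ if $f(x,y)=0$. The polar of a subspace $K$ with respect to $Q$ is the set of all points of $P(V)$ conjugate to every point of $K$. The vertex of $Q$ is the polar of $P(V)$; $Q$ is non-degenerate if its vertex is empty. Cayley-Klein space. Put $A_0=P^n(\mathbb{R})$. A Cayley-Klein space of dimension $n$ is $P^n(\mathbb{R})$ with a sequence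 $Q_0,A_1,Q_1,A_2,\dots,A_r,Q_r,A_{r+1}=\varnothing$ such that, for $0\le i\le r$, $Q_i$ is a quadric in $A_i$ with vertex $A_{i+1}$. Its absolute figure is the sequence of complex extensions $\hat Q_0\supseteq\hat A_1\supseteq\hat Q_1\supseteq\cdots\supseteq\hat A_r\supseteq\hat Q_r\supseteq\hat A_{r+1}=\varnothing$. Total polars. If $X$ is a point with $X\in A_l\setminus A_{l+1}$, a total polar of $X$ is a hyperplane of $P^n(\mathbb{R})$ containing $X^{p_l}$ (the polar of $X$ in $A_l$ with respect to $Q_l$). If $K$ is a $k$-dimensional subspace, a total polar of $K$ is an $(n-k-1)$-dimensional subspace of the form $\bigcap_{i=0}^k H_i$, where $\{X_0,\dots,X_k\}$ is some independent subset $B$ of $K$ with $|B\cap A_j|=\dim(K\cap A_j)+1$ for $0\le j\le r$, each $H_i$ is a total polar of $X_i$, and $\{H_0,\dots,H_k\}$ is independent. ($P^n(\mathbb{R})$ and $\varnothing$ are total polar to each other.) Tangency. A subspace $K$ of $P^n(\mathbb{R})$ is tangent to the absolute figure (a tangent subspace) if there exists a total polar $K^\perp$ of $K$ with $K\cap K^\perp\ne\varnothing$. *)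

(* Defs.v *)
From HB Require Import structures.
From mathcomp Require Import all_boot all_order all_algebra.
From mathcomp Require Import reals.

Set Implicit Arguments.
Unset Strict Implicit.
Unset Printing Implicit Defensive.

Import Order.TTheory GRing.Theory Num.Theory.
Local Open Scope ring_scope.

(* A subspace of the projective space P(V) is a {vspace V}, the empty subspace
   being 0%VS; its projective dimension is its vector dimension minus one.
   A point [x] of P(V) is given by a nonzero representing vector x, and
   corresponds to the subspace <[x]>. *)

Section Projective.

Variables (R : realType) (V : vectType R).

Definition hyperplane_of (S H : {vspace V}) : Prop :=
  (H <= S)%VS /\ (\dim H).+1 = \dim S.

(* The linear form of a hyperplane is unique up to a nonzero scalar, so the
   choice of the forms phi does not matter. *)
Definition independent_hyperplanes k (H : k.-tuple {vspace V}) : Prop :=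
  exists phi : k.-tuple 'Hom(V, R^o),
    free phi /\ forall i : 'I_k, tnth H i = lker (tnth phi i).

Record quadric := Quadric {
  qform : {symmetric V};
  qform_neq0 : exists x y : V, qform x y != 0 }.

Definition quadric_set (Q : quadric) (x : V) : Prop := qform Q x x = 0.

Definition polar (Q : quadric) (K : {vspace V}) : {vspace V} :=
  orthov (qform Q) K.

Definition vertex (Q : quadric) : {vspace V} := polar Q fullv.

End Projective.

(* A quadric in the subspace S of P(V) is a quadric of the projective space
   P(S), i.e. of type quadric (subvs_of S). The next three definitions move
   its points, polars and vertex from P(S) to P(V). *)
Section QuadricInSubspace.

Variables (R : realType) (V : vectType R) (S : {vspace V}).
Variable Q : quadric (subvs_of S).

Let incl : 'Hom(subvs_of S, V) := linfun vsval.

Definition quadric_set_in (x : V) : Prop :=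
  exists2 u : subvs_of S, vsval u = x & quadric_set Q u.

Definition polar_in (K : {vspace V}) : {vspace V} :=
  (incl @: polar Q (incl @^-1: K))%VS.

Definition vertex_in : {vspace V} := (incl @: vertex Q)%VS.

End QuadricInSubspace.

(* The terms ck_A i with i > ck_r.+1 are irrelevant. *)
Record cayley_klein (R : realType) (n : nat) := CayleyKlein {
  ck_r : nat;
  ck_A : nat -> {vspace 'rV[R]_n.+1};
  ck_Q : forall i : 'I_ck_r.+1, quadric (subvs_of (ck_A i));
  ck_A_first : ck_A 0 = fullv;
  ck_A_last : ck_A ck_r.+1 = 0%VS;
  ck_vertex : forall i : 'I_ck_r.+1, vertex_in (ck_Q i) = ck_A i.+1 }.

Section TotalPolars.

Variables (R : realType) (n : nat) (C : cayley_klein R n).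

Local Notation V := 'rV[R]_n.+1.

Definition total_polar_point (x : V) (H : {vspace V}) : Prop :=
  hyperplane_of fullv H /\
  exists l : 'I_(ck_r C).+1,
    [/\ x \in ck_A C l, x \notin ck_A C l.+1
      & (polar_in (ck_Q l) <[x]> <= H)%VS].

Definition total_polar (K Kp : {vspace V}) : Prop :=
  \dim Kp = (n.+1 - \dim K)%N /\
  exists (B : (\dim K).-tuple V) (H : (\dim K).-tuple {vspace V}),
    [/\ free B /\ {subset B <= K},
        forall j : 'I_(ck_r C).+1,
          count [in ck_A C j] B = \dim (K :&: ck_A C j),
        forall i : 'I_(\dim K), total_polar_point (tnth B i) (tnth H i),
        independent_hyperplanes H
      & Kp = (\bigcap_(i < \dim K) tnth H i)%VS].

Definition tangent (K : {vspace V}) : Prop :=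
  exists2 Kp : {vspace V}, total_polar K Kp & (K :&: Kp)%VS <> 0%VS.

End TotalPolars.

(* Main.v *)
Require Import Defs.
From HB Require Import structures.
From mathcomp Require Import all_boot all_order all_algebra.
From mathcomp Require Import reals.

Set Implicit Arguments.
Unset Strict Implicit.
Unset Printing Implicit Defensive.

Import Order.TTheory GRing.Theory Num.Theory.
Local Open Scope ring_scope.

(** Write [f] for the bilinear form of [Q0]; its radical is [A_1], and a point
    outside [A_1] has its [Q0]-polar as only total polar.

    If [L] misses [A_1], the only total polar of [L] is therefore its polar with
    respect to [f], so [L] is tangent iff [f] restricted to [L] is degenerate,
    which gives both equivalences by elementary algebra in dimension two.

    If [L] meets [A_1] in a point [a], then [a] is conjugate to every point, so
    both right-hand sides hold. Moreover [L] is tangent: the total polar of [a]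
    may be any hyperplane containing [A_1], and since [A_1] has codimension at
    least two one of them differs from the polar of [x]; its intersection with
    that polar is a total polar of [L] containing [a]. *)

Lemma free2 (K : fieldType) (V : vectType K) (u v : V) :
  free [:: u; v] = (u \notin <[v]>%VS) && (v != 0).
Proof. by rewrite free_cons span_seq1 seq1_free. Qed.

Lemma free2C (K : fieldType) (V : vectType K) (u v : V) :
  free [:: u; v] = free [:: v; u].
Proof. by apply: perm_free; rewrite (perm_catC [:: u] [:: v]). Qed.

(** * Kernels of linear forms *)

Section LinearForms.

Variables (K : fieldType) (V : vectType K).
Implicit Types (u v : V) (U : {vspace V}) (phi psi : 'Hom(V, K^o)).

Lemma dim_cap_lker phi U : ~~ (U <= lker phi)%VS ->
  (\dim (U :&: lker phi)).+1 = \dim U.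
Proof.
move=> nU; rewrite -(limg_ker_dim phi U).
suff -> : \dim (phi @: U) = 1%N by rewrite addn1.
apply/eqP; rewrite eqn_leq lt0n dimv_eq0 -lkerE nU andbT.
by rewrite (leq_trans (dimvS (subvf _))) // dimvf.
Qed.

Lemma fullv_sub_lker phi : (fullv <= lker phi)%VS = (phi == 0).
Proof.
apply/subvP/eqP => [ker|-> v _]; last by rewrite memv_ker lfunE.
by apply/lfunP => v; move: (ker v (memvf v)); rewrite memv_ker lfunE => /eqP.
Qed.

Lemma dim_lker phi : phi != 0 -> (\dim (lker phi)).+1 = \dim {:V}.
Proof. by move=> phi0; rewrite -[lker phi]capfv dim_cap_lker ?fullv_sub_lker. Qed.

(** Pick [v] with [phi v] nonzero: the scalar must be [psi v / phi v], and every vector differs from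
    a multiple of [v] by an element of [lker phi]. *)
Lemma mem_line_lker phi psi : phi != 0 -> (lker phi <= lker psi)%VS ->
  psi \in <[phi]>%VS.
Proof.
rewrite -fullv_sub_lker => /subvPn [v _]; rewrite memv_ker => phiv /subvP ker.
apply/vlineP; exists (psi v / phi v); apply/lfunP => u; rewrite scale_lfunE.
have /ker : u - (phi u / phi v) *: v \in lker phi.
  by rewrite memv_ker linearB linearZ /= [_ *: _]divfK // subrr.
rewrite memv_ker linearB linearZ /= subr_eq0 => /eqP ->.
by rewrite /GRing.scale /= mulrAC [RHS]mulrAC [phi u * _]mulrC.
Qed.

Lemma dim_cap_lker2 phi psi : free [:: phi; psi] ->
  (\dim (lker phi :&: lker psi)).+2 = \dim {:V}.
Proof.
rewrite free2 => /andP [phiN psi0]; rewrite capvC dim_cap_lker ?dim_lker //.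
by apply: contra phiN; apply: mem_line_lker.
Qed.

End LinearForms.

(** * A quadric in the whole space, expressed through linear forms *)

Section AmbientQuadric.

Variables (R : realType) (V : vectType R) (S : {vspace V}).
Variable Q : quadric (subvs_of S).
Hypothesis SV : S = fullv.

(** [Q] lives on the type [subvs_of S], and [A_0] is the full space only up to a provable equality,
    so the form is carried to [V] along [vsproj S]. *)
Definition polar_form (x : V) : 'Hom(V, R^o) :=
  (linfun (applyr (qform Q) (vsproj S x) : subvs_of S -> R^o)
     \o linfun (vsproj S))%VF.

Lemma polar_formE x v : polar_form x v = qform Q (vsproj S v) (vsproj S x).
Proof. by rewrite comp_lfunE !lfunE. Qed.

Lemma polar_formC x v : polar_form x v = polar_form v x.
Proof. by rewrite !polar_formE hermC mul1r. Qed.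

(** Symmetry turns linearity in the argument into linearity in the point; the kernel of the
    resulting map is the vertex. *)
Lemma polar_form_is_linear : linear polar_form.
Proof.
move=> k x y; apply/lfunP => v; rewrite polar_formC linearP add_lfunE scale_lfunE.
by rewrite [polar_form x v]polar_formC [polar_form y v]polar_formC.
Qed.

HB.instance Definition _ :=
  GRing.isLinear.Build R V 'Hom(V, R^o) _ polar_form polar_form_is_linear.

Let memS v : v \in S. Proof. by rewrite SV memvf. Qed.

Lemma quadric_set_inP x : quadric_set_in Q x <-> polar_form x x = 0.
Proof.
rewrite polar_formE; split=> [[u <-]|fx]; first by rewrite /quadric_set vsvalK.
by exists (vsproj S x); rewrite ?vsprojK.
Qed.

Lemma polar_in1E x : polar_in Q <[x]>%VS = lker (polar_form x).
Proof.
apply/vspaceP => v; rewrite memv_ker polar_formE.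
apply/memv_imgP/eqP => [[u uK ->]|fv].
  rewrite lfunE /= vsvalK.
  move/mem_orthovP: uK; apply.
  by rewrite -memv_preim lfunE /= vsprojK // memv_line.
exists (vsproj S v); last by rewrite lfunE /= vsprojK.
apply/mem_orthovP => w; rewrite -memv_preim lfunE /= => /vlineP [k wk].
by rewrite -[w]vsvalK wk linearZ linearZr /= fv mulr0.
Qed.

Lemma vertex_inE x : (x \in vertex_in Q) = (polar_form x == 0).
Proof.
apply/memv_imgP/eqP => [[u uK ->]|fx].
  apply/lfunP => v; rewrite polar_formC polar_formE !lfunE /= vsvalK.
  by move/mem_orthovP: uK; apply; rewrite memvf.
exists (vsproj S x); last by rewrite lfunE /= vsprojK.
apply/mem_orthovP => w _.
move/lfunP/(_ (vsval w)): fx.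
by rewrite polar_formC polar_formE vsvalK lfunE.
Qed.

End AmbientQuadric.

(** * Bases of a projective line *)

Section Lines.

Variables (K : fieldType) (V : vectType K).
Implicit Types (u v : V) (L : {vspace V}).

Lemma line_addv L u v : \dim L = 2 -> u \in L -> v \in L -> free [:: u; v] ->
  L = (<[u]> + <[v]>)%VS.
Proof.
move=> dL uL vL fuv; apply/eqP; rewrite eq_sym eqEdim subv_add -!memvE uL vL /=.
by move: fuv; rewrite dL /free span_cons span_seq1 => /eqP ->.
Qed.

Lemma line_free2 L u : \dim L = 2 -> u != 0 ->
  exists2 v, v \in L & free [:: u; v].
Proof.
move=> dL u0; have /subvPn [v vL vNu] : ~~ (L <= <[u]>)%VS.
  by apply/negP => /dimvS; rewrite dL dim_vline u0.
by exists v; rewrite // free2C free2 vNu.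
Qed.

End Lines.

(** * The chain of vertices, total polars and tangent lines *)

Section CayleyKlein.

Variables (R : realType) (n : nat) (C : cayley_klein R n).
Local Notation V := 'rV[R]_n.+1.
Local Notation A := (ck_A C).
Local Notation Q0 := (ck_Q (c := C) ord0).
Local Notation phi := (polar_form Q0).
Implicit Types (u x z a : V) (L H : {vspace V}).

Let A0 : A (ord0 : 'I_(ck_r C).+1) = fullv := ck_A_first C.

Lemma ck_A_step (i : 'I_(ck_r C).+1) : (A i.+1 <= A i)%VS.
Proof.
rewrite -(ck_vertex i); apply/subvP => _ /memv_imgP [u _ ->].
by rewrite lfunE /= subvsP.
Qed.

(** The upper bound on [j] matters: later terms of the sequence are arbitrary. *)
Lemma ck_A_sub1 j : (0 < j <= (ck_r C).+1)%N -> (A j <= A 1)%VS.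
Proof.
elim: j => // -[|j] IH //= jr; apply: subv_trans (IH _); last exact: ltnW.
exact: (ck_A_step (Ordinal jr)).
Qed.

Lemma mem_ck_A1 x : (x \in A 1) = (phi x == 0).
Proof. by rewrite -(ck_vertex ord0) vertex_inE. Qed.

Lemma ck_A1_sub_lker z : (A 1 <= lker (phi z))%VS.
Proof.
by apply/subvP => a; rewrite mem_ck_A1 memv_ker polar_formC => /eqP ->; rewrite lfunE.
Qed.

Lemma hyperplane_lker (f : 'Hom(V, R^o)) : f != 0 -> hyperplane_of fullv (lker f).
Proof. by move=> f0; split; [exact: subvf | exact: dim_lker]. Qed.

(** Every later [A l] lies in [A 1], so the level of [x] is 0; its polar is then already a
    hyperplane, and [H] contains it with equal dimension. *)
Lemma total_polar_point_notin x H : x \notin A 1 ->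
  total_polar_point C x H <-> H = lker (phi x).
Proof.
move=> xA; have phix : phi x != 0 by rewrite -mem_ck_A1.
split=> [[[_ dH] [l [xl _ lH]]]|->]; last first.
  split; first exact: hyperplane_lker.
  exists ord0; split; [by rewrite A0 memvf | exact: xA |].
  by rewrite (polar_in1E _ A0).
have l0 : l = ord0.
  apply/val_inj => /=; case: (posnP l) => // l0; case/negP: xA.
  by apply: subvP xl; apply: ck_A_sub1; rewrite l0 ltnW.
move: lH; rewrite l0 (polar_in1E _ A0) => kH.
by apply/eqP; rewrite eq_sym eqEdim kH -ltnS dim_lker // -dH leqnn.
Qed.

(** The level is the predecessor of the first index whose subspace misses [a]. *)
Lemma ck_level a : a != 0 ->
  exists2 l : 'I_(ck_r C).+1, a \in A l & a \notin A l.+1.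
Proof.
move=> a0; have aN : exists j, a \notin A j.
  by exists (ck_r C).+1; rewrite ck_A_last memv0.
case: (ex_minnP aN) => -[|l] aNl lmin; first by rewrite ck_A_first memvf in aNl.
have lr : (l < (ck_r C).+1)%N by apply: lmin; rewrite ck_A_last memv0.
exists (Ordinal lr) => //=; apply/negPn/negP => /lmin.
by rewrite ltnn.
Qed.

(** The level [l] of [a] is positive, so its polar in [A l] lies in [A 1], the radical, which every
    [lker (phi z)] contains. *)
Lemma total_polar_point_in a z : a != 0 -> a \in A 1 -> z \notin A 1 ->
  total_polar_point C a (lker (phi z)).
Proof.
move=> a0 aA zA; split; first by apply: hyperplane_lker; rewrite -mem_ck_A1.
have [l al aNl] := ck_level a0; exists l; split=> //.
have l_gt0 : (0 < l)%N by rewrite lt0n; apply: contraNneq aNl => ->.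
have lA : (A l <= A 1)%VS by apply: ck_A_sub1; rewrite l_gt0 ltnW.
apply: subv_trans (ck_A1_sub_lker z); apply: subv_trans lA.
by apply/subvP => _ /memv_imgP [u _ ->]; rewrite lfunE /= subvsP.
Qed.

(** The tuples in [total_polar] have the dependent length [\dim L]; making it the literal 2 allows
    explicit pairs. *)
Lemma total_polar_lineE L Kp : \dim L = 2 ->
  total_polar C L Kp <->
  \dim Kp = (n.+1 - 2)%N /\
  exists (B : 2.-tuple V) (H : 2.-tuple {vspace V}),
    [/\ free B /\ {subset B <= L},
        forall j : 'I_(ck_r C).+1, count [in A j] B = \dim (L :&: A j),
        forall i : 'I_2, total_polar_point C (tnth B i) (tnth H i),
        independent_hyperplanes H
      & Kp = (\bigcap_(i < 2) tnth H i)%VS].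
Proof. by move=> dL; rewrite /total_polar dL. Qed.

(** For positive [j] only [a] can be counted, and [L :&: A j] is [<[a]>] or 0 according to whether
    [a] lies in [A j]. *)
Lemma count_ck_A L x a : \dim L = 2 -> x \in L -> a \in L ->
  free [:: x; a] -> x \notin A 1 -> (L :&: A 1 <= <[a]>)%VS ->
  forall j : 'I_(ck_r C).+1, count [in A j] [:: x; a] = \dim (L :&: A j).
Proof.
move=> dL xL aL fxa xA LA j; case: (posnP j) => [j0|j_gt0] /=.
  by rewrite j0 ck_A_first !memvf capvf dL.
have jA : (A j <= A 1)%VS by apply: ck_A_sub1; rewrite j_gt0 ltnW.
have /negPf xNj : x \notin A j by apply: contra xA; apply: subvP.
have a0 : a != 0 by move: fxa; rewrite free2 => /andP[].
rewrite xNj add0n addn0.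
have LAj : (L :&: A j <= <[a]>)%VS by apply: subv_trans LA; apply: capvS.
case: (boolP (a \in A j)) => aj.
  suff -> : (L :&: A j)%VS = <[a]>%VS by rewrite dim_vline a0.
  by apply/eqP; rewrite eqEsubv LAj -memvE memv_cap aL.
apply/eqP; rewrite eq_sym dimv_eq0 -subv0; apply/subvP => u uLA.
have /vlineP [k uE] := subvP LAj _ uLA; move: uLA; rewrite uE memv_cap => /andP[_].
by rewrite rpredZeq (negPf aj) orbF memv0 scaler_eq0 => ->.
Qed.

(** If [phi z] were [k *: phi x], then [z - k *: x] would lie in the radical [A 1]. *)
Lemma free_polar_form x z : x \notin A 1 -> z \notin (<[x]> + A 1)%VS ->
  free [:: phi x; phi z].
Proof.
move=> xA zN; rewrite free2C free2 -mem_ck_A1 xA andbT.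
apply: contra zN => /vlineP [k zk].
rewrite -[z](subrK (k *: x)) addrC memv_add ?memvZ ?memv_line //.
by rewrite mem_ck_A1 linearB linearZ /= zk subrr.
Qed.

(* In both cases of the proof the total polar of [a] is the [Q0]-polar of a
   suitable point [z]: [z = a] if [L] misses [A_1], any [z] outside the span of
   [x] and [A_1] otherwise. *)
Lemma tangent_intro L x a z u : \dim L = 2 -> x \in L -> a \in L ->
  free [:: x; a] -> x \notin A 1 -> (L :&: A 1 <= <[a]>)%VS ->
  z \notin (<[x]> + A 1)%VS -> total_polar_point C a (lker (phi z)) ->
  u \in L -> u != 0 -> phi x u = 0 -> phi z u = 0 -> tangent C L.
Proof.
move=> dL xL aL fxa xA LA zN tpa uL u0 xu zu.
have fxz := free_polar_form xA zN.
exists (lker (phi x) :&: lker (phi z))%VS; last first.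
  apply/eqP; rewrite -subv0; apply/subvPn; exists u; last by rewrite memv0.
  by rewrite !memv_cap uL !memv_ker xu zu !eqxx.
apply/(total_polar_lineE _ dL); split.
  have := dim_cap_lker2 fxz; rewrite dimvf /dim /= mul1n.
  by move=> /(congr1 (subn^~ 2%N)); rewrite subn2.
exists [tuple x; a], [tuple lker (phi x); lker (phi z)]; split.
- by split=> // v; rewrite !inE => /orP [] /eqP ->.
- exact: count_ck_A.
- case=> -[|[|//]] i2; rewrite !(tnth_nth 0) /=; first exact/total_polar_point_notin.
  exact: tpa.
- exists [tuple phi x; phi z]; split=> //.
  by case=> -[|[|//]] i2; rewrite !(tnth_nth 0).
- by rewrite !big_ord_recl big_ord0 capvf !(tnth_nth 0%VS).
Qed.

Lemma tangent_meets_A1 L x a : ~ hyperplane_of fullv (A 1) -> \dim L = 2 ->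
  x \in L -> x \notin A 1 -> a \in L -> a \in A 1 -> a != 0 -> tangent C L.
Proof.
move=> hA1 dL xL xA aL aA a0.
have fxa : free [:: x; a].
  rewrite free2 a0 andbT; apply: contra xA => /vlineP [k ->].
  exact: memvZ.
(* Otherwise [A 1] has codimension at most one; as it misses [x] it is proper, hence a hyperplane,
   against [hA1]. *)
have [z zN] : exists z, z \notin (<[x]> + A 1)%VS.
  suff /subvPn [z _ zN] : ~~ (fullv <= <[x]> + A 1)%VS by exists z.
  apply/negP => full; apply: hA1; split; first exact: subvf.
  apply/eqP; rewrite eqn_leq; apply/andP; split.
    rewrite ltnNge; apply/negP => le; case/negP: xA.
    by have /eqP -> : A 1 == fullv; rewrite ?memvf // eqEdim subvf.
  apply: leq_trans (dimvS full) _; apply: leq_trans (dimv_add_leqif _ _) _.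
  by rewrite dim_vline addnC; case: (x != 0); rewrite /= ?addn1 ?addn0.
have zA : z \notin A 1 by apply: contra zN; apply/subvP/addvSr.
apply: (tangent_intro dL xL aL fxa xA _ zN (total_polar_point_in a0 aA zA) aL a0).
- rewrite (line_addv dL xL aL fxa); apply/subvP => v; rewrite memv_cap.
  case/andP=> /memv_addP [_ /vlineP [k ->] [w /vlineP [m ->] ->]].
  rewrite (rpredDr _ (memvZ m aA)) rpredZeq (negPf xA) orbF => /eqP ->.
  by rewrite scale0r add0r memvZ ?memv_line.
- by move: aA; rewrite polar_formC mem_ck_A1 => /eqP ->; rewrite lfunE.
- by move: aA; rewrite polar_formC mem_ck_A1 => /eqP ->; rewrite lfunE.
Qed.

(** The right-hand side says that the form restricted to [L] is degenerate. *)
Lemma tangent_avoids_A1 L : \dim L = 2 -> (L :&: A 1)%VS = 0%VS ->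
  tangent C L <->
  exists2 u, (u \in L) && (u != 0) & forall y, y \in L -> phi y u = 0.
Proof.
move=> dL LA; have LNA b : b \in L -> b != 0 -> b \notin A 1.
  by move=> bL b0; apply: contra b0 => bA; rewrite -memv0 -LA memv_cap bL.
split=> [[Kp /(total_polar_lineE _ dL)]|[u /andP [uL u0] uP]].
  case=> _ [B [H [[fB BL] _ tp _ KpE]]] /eqP; rewrite -subv0 => /subvPn [u].
  rewrite memv_cap memv0 => /andP [uL uKp] u0; exists u; first by rewrite uL.
  (* Basis points avoid [A 1], so their hyperplanes are forced to be their polars, all of which
     contain [u]. *)
  have Bu i : phi (tnth B i) u = 0.
    have bL : tnth B i \in L by apply: BL; apply: mem_tnth.
    have b0 : tnth B i != 0 := free_not0 fB (mem_tnth i B).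
    have /(total_polar_point_notin _ (LNA _ bL b0)) HE := tp i.
    apply/eqP; rewrite -memv_ker -HE.
    by apply: subvP uKp; rewrite KpE; apply: bigcapv_inf.
  have LE : L = <<B>>%VS.
    apply/eqP; rewrite eq_sym eqEdim dL; apply/andP; split; first exact/span_subvP.
    by move: fB; rewrite /free => /eqP ->; rewrite size_tuple.
  move=> y; rewrite LE => /coord_span ->; rewrite linear_sum sum_lfunE big1 // => i _.
  by rewrite linearZ scale_lfunE /= -tnth_nth Bu scaler0.
(* Conversely, complete [u] to a basis of [L]; the polars of [u] and [a] both contain [u]. *)
have [a aL fua] := line_free2 dL u0.
have a0 : a != 0 by move: fua; rewrite free2 => /andP [].
have aA := LNA _ aL a0.
apply: (tangent_intro dL uL aL fua (LNA _ uL u0) _ _ _ uL u0 (uP _ uL) (uP _ aL)).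
- by rewrite LA sub0v.
(* If [a = k *: u + w] with [w] in [A 1], then [w] is also in [L], hence zero, and [a] is
   proportional to [u]. *)
- apply: contraL fua => /memv_addP [_ /vlineP [k ->] [w wA aE]].
  rewrite free2C free2 u0 andbT negbK aE.
  have : w \in (L :&: A 1)%VS.
    by rewrite memv_cap wA andbT -[w](addKr (k *: u)) -aE rpredD ?rpredN ?memvZ.
  by rewrite LA memv0 => /eqP ->; rewrite addr0 memvZ ?memv_line.
- exact/total_polar_point_notin.
Qed.

End CayleyKlein.

Theorem proposition4p3 (R : realType) (n : nat) (C : cayley_klein R n)
    (hA1 : ~ hyperplane_of fullv (ck_A C 1))
    (x : 'rV[R]_n.+1) (hx : x != 0) (hxA1 : x \notin ck_A C 1)
    (L : {vspace 'rV[R]_n.+1}) (hL : \dim L = 2%N) (hxL : x \in L) :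
  let Q0 := ck_Q (c := C) ord0 in
  let Xp := polar_in Q0 <[x]>%VS in
  (~ quadric_set_in Q0 x ->
    (tangent C L <->
     exists y : 'rV[R]_n.+1,
       [/\ y != 0, y \in L, y \in Xp & quadric_set_in Q0 y])) /\
  (quadric_set_in Q0 x -> (tangent C L <-> (L <= Xp)%VS)).
Proof.
move=> Q0 Xp; have A0 : ck_A C (ord0 : 'I_(ck_r C).+1) = fullv := ck_A_first C.
have qE y := quadric_set_inP Q0 A0 y.
have XpE : Xp = lker (polar_form Q0 x) := polar_in1E Q0 A0 x.
have LP y : free [:: x; y] -> y \in L -> L = (<[x]> + <[y]>)%VS.
  by move=> fxy yL; apply: line_addv.
have [LA|/eqP] := eqVneq (L :&: ck_A C 1)%VS 0%VS; last first.
  move=> /eqP; rewrite -subv0 => /subvPn [a].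
  rewrite memv_cap memv0 => /andP [aL aA] a0.
  have tL := tangent_meets_A1 hA1 hL hxL hxA1 aL aA a0.
  have pa0 : polar_form Q0 a = 0 by apply/eqP; rewrite -mem_ck_A1.
  have aXp : a \in Xp by rewrite XpE memv_ker polar_formC pa0 lfunE.
  split=> [_|/qE xQ]; split=> // _.
    by exists a; split=> //; apply/qE; rewrite pa0 lfunE.
  rewrite (LP a) // ?subv_add -?memvE ?aXp ?andbT ?XpE ?memv_ker ?xQ //.
  rewrite free2 a0 andbT; apply: contra hxA1 => /vlineP [k ->].
  exact: memvZ.
have tE := tangent_avoids_A1 hL LA.
split=> [xNQ|/qE xQ]; rewrite tE XpE; split.
- case=> u /andP [uL u0] uP; exists u; split=> //; last by apply/qE/uP.
  by rewrite memv_ker uP.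
- case=> y [y0 yL]; rewrite memv_ker => /eqP xy /qE yy.
  (* A multiple of [y] is conjugate to [y], so [x = k *: y] would put [x] on the quadric. Thus [x]
     and [y] span [L], and [y] is conjugate to both. *)
  have fxy : free [:: x; y].
    rewrite free2 y0 andbT; apply/negP => /vlineP [k xk]; apply: xNQ.
    by apply/qE; rewrite {2}xk linearZ /= xy scaler0.
  exists y; first by rewrite yL.
  move=> v; rewrite (LP y fxy yL) => /memv_addP [_ /vlineP [k ->] [w /vlineP [m ->] ->]].
  by rewrite linearD !linearZ /= add_lfunE !scale_lfunE xy yy !scaler0 addr0.
- case=> u /andP [uL u0] uP; have xu := uP x hxL.
  (* Either [x] and [u] span [L] and both lie in [Xp], or [x] is a multiple of [u] and inherits its
     conjugacy to all of [L]. *)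
  case: (boolP (free [:: x; u])) => [fxu|].
    by rewrite (LP u) // subv_add -!memvE !memv_ker xQ xu eqxx.
  rewrite free2 u0 andbT negbK => /vlineP [k xk].
  apply/subvP => v vL; rewrite memv_ker {1}xk linearZ /= scale_lfunE.
  by rewrite polar_formC uP // scaler0.
- move=> LX; exists x; first by rewrite hxL.
  move=> y yL; rewrite polar_formC; apply/eqP; rewrite -memv_ker.
  exact: subvP LX _ yL.
Qed.
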